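(* $\mathsf{ConC}_{[0,1]}\,|_W\,\mathsf{PC}_\mathbb{R}$, i.e. neither $\mathsf{ConC}_{[0,1]}\le_W\mathsf{PC}_\mathbb{R}$ nor $\mathsf{PC}_\mathbb{R}\le_W\mathsf{ConC}_{[0,1]}$. In particular also $\mathsf{ConC}_{[0,1]}\not\le_W\mathsf{PC}_{[0,1]}$.
   Context: A represented space is a pair $(X,\delta_X)$ with $\delta_X:\subseteq\mathbb{N}^\mathbb{N}\to X$ a partial surjection; $[0,1]$ and $\mathbb R$ carry their Cauchy representations. A realizer of $f:\subseteq X\rightrightarrows Y$ is a partial $F$ with $\delta_Y F(p)\in f(\delta_X(p))$ for all $p\in\mathrm{dom}(f\circ\delta_X)$. $f\le_W g$ if there are computable partial $H,K:\subseteq\mathbb{N}^\mathbb{N}\to\mathbb{N}^\mathbb{N}$ such that $p\mapsto H\langle p,GK(p)\rangle$ realizes $f$ for every realizer $G$ of $g$. $\mathcal{A}_-(X)$ denotes the closed subsets of $X$ represented by negative information (a name of $A$ enumerates rational open intervals whose union is $X\setminus A$). Closed choice $\mathsf C_X:\subseteq\mathcal A_-(X)\rightrightarrows X$, $A\mapsto A$, is defined on nonempty $A$. $\mathsf{ConC}_{[0,1]}$ is $\mathsf C_{[0,1]}$ restricted to nonempty connected closed sets, i.e., intervals $[a,b]$ with $0\le a\le b\le1$ (singletons included). $\mathsf{PC}_X$ is $\mathsf C_X$ restricted to closed $A$ with positive Lebesgue measure. *)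

(* Defs.v *)
From Stdlib Require Import Reals Lra Lia Arith List Cantor.
Open Scope R_scope.

Definition Baire := nat -> nat.

Definition bpair (p q : Baire) : Baire :=
  fun n => if Nat.even n then p (Nat.div2 n) else q (Nat.div2 n).

(** * Oracle mu-recursive functions (model of Type-2 computability)
    Arguments are lists of naturals (missing arguments read as 0). *)
Inductive term : Type :=
| TZero : term
| TSucc : term
| TProj : nat -> term
| TOracle : term
| TComp : term -> list term -> term
| TRec : term -> term -> term
| TMu : term -> term.

Inductive eval (p : Baire) : term -> list nat -> nat -> Prop :=
| ev_zero args : eval p TZero args 0
| ev_succ args : eval p TSucc args (S (hd 0%nat args))
| ev_proj i args : eval p (TProj i) args (nth i args 0%nat)
| ev_oracle args : eval p TOracle args (p (hd 0%nat args))
| ev_comp f gs args ys r :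
    evals p gs args ys -> eval p f ys r -> eval p (TComp f gs) args r
| ev_rec g h args r :
    receval p g h (hd 0%nat args) (tl args) r -> eval p (TRec g h) args r
| ev_mu f args x :
    eval p f (x :: args) 0%nat ->
    (forall y, (y < x)%nat -> exists m, eval p f (y :: args) (S m)) ->
    eval p (TMu f) args x
with evals (p : Baire) : list term -> list nat -> list nat -> Prop :=
| evs_nil args : evals p nil args nil
| evs_cons g gs args y ys :
    eval p g args y -> evals p gs args ys -> evals p (g :: gs) args (y :: ys)
with receval (p : Baire) : term -> term -> nat -> list nat -> nat -> Prop :=
| rec_zero g h ys r : eval p g ys r -> receval p g h 0%nat ys r
| rec_succ g h x ys r r' :
    receval p g h x ys r -> eval p h (x :: r :: ys) r' ->
    receval p g h (S x) ys r'.

(** The oracle machine [t] on input (oracle) [p] outputs the sequence [q]: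
    q(n) = t^p(n) for every n. Its graph is the computable partial function
    F_t :⊆ Baire -> Baire computed by [t]. *)
Definition runs (t : term) (p q : Baire) : Prop :=
  forall n, eval p t (n :: nil) (q n).

Record rep_space := {
  carrier : Type;
  delta : Baire -> carrier -> Prop
}.

Record mvmap (X Y : Type) := {
  mdom : X -> Prop;
  mval : X -> Y -> Prop
}.
Arguments mdom {X Y}.
Arguments mval {X Y}.

Definition functional (F : Baire -> Baire -> Prop) : Prop :=
  forall p q q', F p q -> F p q' -> forall n, q n = q' n.

Definition realizes (X Y : rep_space) (f : mvmap (carrier X) (carrier Y))
    (F : Baire -> Baire -> Prop) : Prop :=
  forall p x, delta X p x -> mdom f x ->
    (exists q, F p q) /\
    (forall q, F p q -> exists y, delta Y q y /\ mval f x y).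

Definition W_le (X Y Z W : rep_space)
    (f : mvmap (carrier X) (carrier Y)) (g : mvmap (carrier Z) (carrier W))
    : Prop :=
  exists tK tH : term,
    forall G : Baire -> Baire -> Prop,
      functional G -> realizes Z W g G ->
      realizes X Y f
        (fun p r => exists k q, runs tK p k /\ G k q /\ runs tH (bpair p q) r).

Definition zdecode (a : nat) : Z :=
  if Nat.even a then Z.of_nat (Nat.div2 a) else (- Z.of_nat (Nat.div2 (S a)))%Z.

Definition nu_Q (n : nat) : R :=
  let (a, b) := Cantor.of_nat n in IZR (zdecode a) / INR (S b).

Definition interval_code (n : nat) (x : R) : Prop :=
  let (a, b) := Cantor.of_nat n in nu_Q a < x < nu_Q b.

Definition RR : rep_space := {|
  carrier := R;
  delta := fun p x => forall n, Rabs (nu_Q (p n) - x) <= / 2 ^ n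
|}.

Definition unit_I (x : R) : Prop := 0 <= x <= 1.

Definition II : rep_space := {|
  carrier := R;
  delta := fun p x => unit_I x /\ forall n, Rabs (nu_Q (p n) - x) <= / 2 ^ n
|}.

Definition AminusR : rep_space := {|
  carrier := R -> Prop;
  delta := fun p A => forall x, ~ A x <-> exists i, interval_code (p i) x
|}.

Definition AminusI : rep_space := {|
  carrier := R -> Prop;
  delta := fun p A =>
    (forall x, A x -> unit_I x) /\
    forall x, unit_I x -> (~ A x <-> exists i, interval_code (p i) x)
|}.

Definition lebesgue_null (A : R -> Prop) : Prop :=
  forall eps, 0 < eps ->
    exists a b : nat -> R,
      (forall i, a i <= b i) /\
      (forall x, A x -> exists i, a i < x < b i) /\
      (forall n, sum_f_R0 (fun i => b i - a i) n <= eps).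

(** positive Lebesgue measure (for the closed, hence measurable, sets
    in question this is λ(A) > 0) *)
Definition positive_measure (A : R -> Prop) : Prop := ~ lebesgue_null A.

Definition nonempty (A : R -> Prop) : Prop := exists x, A x.

Definition ConC_I : mvmap (carrier AminusI) (carrier II) := {|
  mdom := fun A => exists a b, 0 <= a /\ a <= b /\ b <= 1 /\
                               forall x, A x <-> a <= x <= b;
  mval := fun A x => A x
|}.

Definition PC_R : mvmap (carrier AminusR) (carrier RR) := {|
  mdom := fun A => nonempty A /\ positive_measure A;
  mval := fun A x => A x
|}.

Definition PC_I : mvmap (carrier AminusI) (carrier II) := {|
  mdom := fun A => nonempty A /\ positive_measure A;
  mval := fun A x => A x
|}.

(* Main.v *)
(** All three parts are topological: only the finite use of oracle computations
    matters.  If interval choice reduced to positive choice, consider the name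
    of an interval.  By compactness, after reading finitely many entries, a
    bounded part of the query splits into finitely many cells on each of which
    the answer is already bounded away from the left or from the right third
    of the interval.  Restricting the interval to one of these thirds removes
    all cells of one kind, so one choice halves the length of what remains of
    the query.  Iterating this, with growing bounds and shrinking lengths,
    yields a name of an interval whose query is a null set.
    Conversely, if positive choice on [R] reduced to interval choice, start
    with the set [R].  By compactness of [0,1] the first approximation of the
    answer is bounded after finitely many entries, after which the set can
    still be shrunk to an interval beyond that bound. *)
Require Import Defs.
From Stdlib Require Import Reals Lra Lia List Cantor.
From Stdlib Require Import Classical ClassicalEpsilon FunctionalExtensionality.
Import ListNotations.
Open Scope R_scope.

(** * Oracle computations: determinism and finite use *)

Section EvalInduction.
Variable p : Baire.
Variable P : term -> list nat -> nat -> Prop.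
Variable Ps : list term -> list nat -> list nat -> Prop.
Variable Prec : term -> term -> nat -> list nat -> nat -> Prop.
Hypothesis Hzero : forall args, P TZero args 0%nat.
Hypothesis Hsucc : forall args, P TSucc args (S (hd 0%nat args)).
Hypothesis Hproj : forall i args, P (TProj i) args (nth i args 0%nat).
Hypothesis Horacle : forall args, P TOracle args (p (hd 0%nat args)).
Hypothesis Hcomp : forall f gs args ys r,
  Ps gs args ys -> P f ys r -> P (TComp f gs) args r.
Hypothesis Hrec : forall g h args r,
  Prec g h (hd 0%nat args) (tl args) r -> P (TRec g h) args r.
Hypothesis Hmu : forall f args x, P f (x :: args) 0%nat ->
  (forall y, (y < x)%nat -> exists m, P f (y :: args) (S m)) ->
  P (TMu f) args x.
Hypothesis Hnil : forall args, Ps [] args [].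
Hypothesis Hcons : forall g gs args y ys,
  P g args y -> Ps gs args ys -> Ps (g :: gs) args (y :: ys).
Hypothesis Hrec0 : forall g h ys r, P g ys r -> Prec g h 0%nat ys r.
Hypothesis HrecS : forall g h x ys r r',
  Prec g h x ys r -> P h (x :: r :: ys) r' -> Prec g h (S x) ys r'.

(** The premise of [ev_mu] about smaller arguments nests [eval] under an existential. The recursion
    opens that witness, so that [Hmu] receives an induction hypothesis for every [y] below [x]. *)
Fixpoint eval_mutual_ind t args r (H : eval p t args r) {struct H} :
  P t args r :=
  match H in eval _ t args r return P t args r with
  | ev_zero _ args => Hzero args
  | ev_succ _ args => Hsucc args
  | ev_proj _ i args => Hproj i args
  | ev_oracle _ args => Horacle args
  | ev_comp _ f gs args ys r Hs Hf =>
      Hcomp f gs args ys r (evals_mutual_ind gs args ys Hs)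
        (eval_mutual_ind f ys r Hf)
  | ev_rec _ g h args r Hr =>
      Hrec g h args r (receval_mutual_ind g h _ _ r Hr)
  | ev_mu _ f args x H0 Hlt =>
      Hmu f args x (eval_mutual_ind f _ _ H0)
        (fun y Hy => match Hlt y Hy with
                     | ex_intro _ m Hm =>
                         ex_intro _ m (eval_mutual_ind f _ _ Hm)
                     end)
  end
with evals_mutual_ind gs args ys (H : evals p gs args ys) {struct H} :
  Ps gs args ys :=
  match H in evals _ gs args ys return Ps gs args ys with
  | evs_nil _ args => Hnil args
  | evs_cons _ g gs args y ys Hg Hs =>
      Hcons g gs args y ys (eval_mutual_ind g args y Hg)
        (evals_mutual_ind gs args ys Hs)
  end
with receval_mutual_ind g h x ys r (H : receval p g h x ys r) {struct H} :
  Prec g h x ys r :=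
  match H in receval _ g h x ys r return Prec g h x ys r with
  | rec_zero _ g h ys r Hg => Hrec0 g h ys r (eval_mutual_ind g ys r Hg)
  | rec_succ _ g h x ys r r' Hr Hh =>
      HrecS g h x ys r r' (receval_mutual_ind g h x ys r Hr)
        (eval_mutual_ind h _ _ Hh)
  end.
End EvalInduction.

Lemma eval_det p t args r r' :
  eval p t args r -> eval p t args r' -> r = r'.
Proof.
intros H; revert r'.
apply (eval_mutual_ind p
  (fun t args r => forall r', eval p t args r' -> r = r')
  (fun gs args ys => forall ys', evals p gs args ys' -> ys = ys')
  (fun g h x ys r => forall r', receval p g h x ys r' -> r = r'))
  with (12 := H); clear.
- intros args r' H; inversion H; auto.
- intros args r' H; inversion H; auto.
- intros i args r' H; inversion H; auto.
- intros args r' H; inversion H; auto.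
- intros f gs args ys r IHs IHf r' H; inversion H; subst.
  match goal with E : evals _ _ _ _ |- _ => apply IHs in E; subst end.
  now apply IHf.
- intros g h args r IH r' H; inversion H; subst; now apply IH.
- intros f args x IH0 IHlt r' H; inversion H as [| | | | | |? ? ? E0 Elt]; subst.
  (* The smaller of two distinct search results would have value zero and, by the other derivation,
     a successor value. *)
  destruct (Nat.lt_trichotomy x r') as [L|[L|L]]; auto.
  + destruct (Elt x L) as [m Em]; apply IH0 in Em; discriminate.
  + destruct (IHlt r' L) as [m Em]; apply Em in E0; discriminate.
- intros args ys' H; inversion H; auto.
- intros g gs args y ys IHg IHs ys' H; inversion H; subst; f_equal; auto.
- intros g h ys r IH r' H; inversion H; subst; auto.
- intros g h x ys r r1 IHr IHh r' H; inversion H; subst.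
  match goal with E : receval _ _ _ _ _ _ |- _ => apply IHr in E; subst end.
  now apply IHh.
Qed.

Lemma runs_det t p q q' : runs t p q -> runs t p q' -> q = q'.
Proof.
intros H H'; apply functional_extensionality; intros n.
exact (eval_det _ _ _ _ _ (H n) (H' n)).
Qed.

Definition agree (n : nat) (p p' : Baire) : Prop :=
  forall i, (i < n)%nat -> p' i = p i.

Lemma agree_le n m p p' : (n <= m)%nat -> agree m p p' -> agree n p p'.
Proof. intros L H i Hi; apply H; lia. Qed.

Lemma bounded_witness (T : nat -> nat -> Prop) (x : nat) :
  (forall y n m, (n <= m)%nat -> T y n -> T y m) ->
  (forall y, (y < x)%nat -> exists n, T y n) ->
  exists n, forall y, (y < x)%nat -> T y n.
Proof.
intros mono; induction x as [|x IH]; intros H.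
- exists 0%nat; intros; lia.
- destruct IH as [n Hn]; [intros; apply H; lia|].
  destruct (H x) as [m Hm]; [lia|].
  exists (Nat.max n m); intros y Hy.
  destruct (Nat.eq_dec y x) as [->|ne].
  + apply mono with m; auto; lia.
  + apply mono with n; [lia|]; apply Hn; lia.
Qed.

(** A derivation makes only finitely many oracle calls. In the case of [TMu] the finitely many
    smaller arguments have a common bound by [bounded_witness]. *)
Lemma eval_use p t args r :
  eval p t args r -> exists n, forall p', agree n p p' -> eval p' t args r.
Proof.
intros H.
apply (eval_mutual_ind p
  (fun t args r => exists n, forall p', agree n p p' -> eval p' t args r)
  (fun gs args ys => exists n, forall p', agree n p p' -> evals p' gs args ys)
  (fun g h x ys r => exists n, forall p', agree n p p' ->
     receval p' g h x ys r))
  with (12 := H); clear t args r H.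
- intros args; exists 0%nat; intros; constructor.
- intros args; exists 0%nat; intros; constructor.
- intros i args; exists 0%nat; intros; constructor.
- intros args; exists (S (hd 0%nat args)); intros p' Hp.
  rewrite <- Hp by lia; constructor.
- intros f gs args ys r [n Hn] [m Hm]; exists (Nat.max n m); intros p' Hp.
  apply ev_comp with ys.
  + apply Hn, agree_le with (2 := Hp); lia.
  + apply Hm, agree_le with (2 := Hp); lia.
- intros g h args r [n Hn]; exists n; intros p' Hp; constructor; auto.
- intros f args x [n Hn] Hlt.
  destruct (bounded_witness (fun y n => forall p', agree n p p' ->
    exists m, eval p' f (y :: args) (S m)) x) as [m Hm].
  + intros y k l Hkl Hk p' Hp; apply Hk, agree_le with (2 := Hp); lia.
  + intros y Hy; destruct (Hlt y Hy) as [v [k Hk]].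
    exists k; intros p' Hp; exists v; auto.
  + exists (Nat.max n m); intros p' Hp; constructor.
    * apply Hn, agree_le with (2 := Hp); lia.
    * intros y Hy; apply Hm; auto; apply agree_le with (2 := Hp); lia.
- intros args; exists 0%nat; intros; constructor.
- intros g gs args y ys [n Hn] [m Hm]; exists (Nat.max n m); intros p' Hp.
  constructor.
  + apply Hn, agree_le with (2 := Hp); lia.
  + apply Hm, agree_le with (2 := Hp); lia.
- intros g h ys r [n Hn]; exists n; intros; constructor; auto.
- intros g h x ys r r' [n Hn] [m Hm]; exists (Nat.max n m); intros p' Hp.
  apply rec_succ with r.
  + apply Hn, agree_le with (2 := Hp); lia.
  + apply Hm, agree_le with (2 := Hp); lia.
Qed.

Lemma agree_bpair n p p' q q' :
  agree n p p' -> agree n q q' -> agree n (bpair p q) (bpair p' q').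
Proof.
intros Hp Hq i Hi; unfold bpair.
assert (Nat.div2 i <= i)%nat by (apply Nat.div2_decr; lia).
destruct (Nat.even i); [apply Hp|apply Hq]; lia.
Qed.

(** * Weihrauch reductions without realizers *)

(** A realizer sees only the name, so one answer must serve every [z] that [k] names. For [k]
    outside the domain the condition is vacuous. *)
Definition good_answer (Z W : rep_space) (g : mvmap (carrier Z) (carrier W))
    (k q : Baire) : Prop :=
  forall z, delta Z k z -> mdom g z -> exists y, delta W q y /\ mval g z y.

(* A realizer may answer the query [k] by any admissible [q], so a reduction
   has to cope with all of them. *)
Lemma W_le_elim (X Y Z W : rep_space)
    (f : mvmap (carrier X) (carrier Y)) (g : mvmap (carrier Z) (carrier W)) :
  (forall k, exists q, good_answer Z W g k q) ->
  W_le X Y Z W f g ->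
  exists tK tH, forall p x, delta X p x -> mdom f x ->
    exists k, runs tK p k /\ (exists z, delta Z k z /\ mdom g z) /\
      forall q, good_answer Z W g k q ->
        exists r, runs tH (bpair p q) r /\
          exists y, delta Y r y /\ mval f x y.
Proof.
intros Hex [tK [tH HW]]; exists tK, tH; intros p x Hp Hx.
set (dom k := exists z, delta Z k z /\ mdom g z).
set (ans k := epsilon (inhabits k) (good_answer Z W g k)).
assert (Hans : forall k, good_answer Z W g k (ans k))
  by (intros k; apply epsilon_spec, Hex).
assert (main : forall k0 q0, good_answer Z W g k0 q0 ->
  exists k q r, runs tK p k /\ dom k /\ (k = k0 -> q = q0) /\
    runs tH (bpair p q) r /\ exists y, delta Y r y /\ mval f x y).
{ intros k0 q0 H0.
  (* This realizer answers [k0] by [q0] and other queries by [ans]. The conjunct [dom k] makes each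
     successful call prove that the query is admissible. *)
  set (G := fun k q => dom k /\
              ((k = k0 /\ q = q0) \/ (k <> k0 /\ q = ans k))).
  destruct (HW G) with (p := p) (x := x) as [[r Hr] Hall]; auto.
  - intros k q q' [_ [[E ->]|[E ->]]] [_ [[E' ->]|[E' ->]]] n; tauto.
  - intros k z Hk Hz; split.
    + destruct (classic (k = k0)) as [E|E];
        [exists q0|exists (ans k)]; (split; [exists z|]; auto).
    + intros q [_ [[-> ->]|[_ ->]]]; [apply H0|apply Hans]; auto.
  - destruct (Hall r Hr) as [y Hy].
    destruct Hr as [k [q [HK [[Hd HG] HH]]]].
    exists k, q, r; repeat split; eauto.
    intros E; destruct HG as [[_ Eq]|[ne _]]; tauto. }
(* The first run, whose special query [p] is arbitrary, only finds the query [k]. The second makes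
   [k] special; since [tK] is deterministic, [k] is asked again and gets the answer [q1]. *)
destruct (main p (ans p)) as [k [q [r [HK [Hd _]]]]]; auto.
exists k; repeat split; auto.
intros q1 Hq1; destruct (main k q1 Hq1) as [k' [q' [r' [HK' [_ [E [HH Hy]]]]]]].
rewrite <- (E (runs_det _ _ _ _ HK' HK)); eauto.
Qed.

(** * Rational approximation and Cauchy names *)

Lemma zdecode_surj z : exists a, zdecode a = z.
Proof.
destruct (Z.le_gt_cases 0 z) as [H|H].
- exists (2 * Z.to_nat z)%nat; unfold zdecode.
  replace (Nat.even _) with true by (symmetry; rewrite Nat.even_mul; auto).
  rewrite Nat.div2_double; lia.
- exists (S (2 * (Z.to_nat (- z) - 1)))%nat; unfold zdecode.
  rewrite Nat.even_succ, Nat.odd_mul; simpl Nat.odd; simpl andb.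
  replace (S (S (2 * (Z.to_nat (- z) - 1)))) with (2 * Z.to_nat (- z))%nat
    by lia.
  cbv iota; rewrite Nat.div2_double; lia.
Qed.

Lemma nu_Q_dense s t : s < t -> exists n, s < nu_Q n < t.
Proof.
intros L.
(* The denominator is [b] with [/ INR b < t - s], the numerator the least integer above
   [s * INR b]. *)
destruct (archimed_cor1 (t - s)) as [b [Hb Hb0]]; [lra|].
assert (b0 : 0 < INR b) by (apply lt_0_INR; lia).
destruct (archimed (s * INR b)) as [A1 A2].
destruct (zdecode_surj (up (s * INR b))) as [a Ha].
exists (Cantor.to_nat (a, pred b)); unfold nu_Q.
rewrite Cantor.cancel_of_to, Ha.
replace (S (pred b)) with b by lia.
assert (1 < (t - s) * INR b).
{ apply Rmult_lt_compat_r with (r := INR b) in Hb; auto.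
  rewrite Rinv_l in Hb; lra. }
split.
- apply Rmult_lt_reg_r with (INR b); auto.
  unfold Rdiv; rewrite Rmult_assoc, Rinv_l; lra.
- apply Rmult_lt_reg_r with (INR b); auto.
  unfold Rdiv; rewrite Rmult_assoc, Rinv_l; lra.
Qed.

Definition cauchy_name (q : Baire) (y : R) : Prop :=
  forall n, Rabs (nu_Q (q n) - y) <= / 2 ^ n.

Lemma inv_pow2_pos n : 0 < / 2 ^ n.
Proof. apply Rinv_0_lt_compat, pow_lt; lra. Qed.

Lemma inv_pow2_le n m : (n <= m)%nat -> / 2 ^ m <= / 2 ^ n.
Proof.
intros L; apply Rinv_le_contravar; [apply pow_lt; lra|].
apply Rle_pow; [lra|auto].
Qed.

Lemma inv_pow2_small eps : 0 < eps -> exists n, / 2 ^ n < eps.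
Proof.
intros He; destruct (pow_lt_1_zero (/ 2)) with (y := eps) as [n Hn]; auto.
- rewrite Rabs_pos_eq; lra.
- exists n; specialize (Hn n (Nat.le_refl n)).
  rewrite pow_inv, Rabs_pos_eq in Hn; auto.
  apply Rlt_le, inv_pow2_pos.
Qed.

(* The precision twice as good as required leaves room to move the point
   without changing a given finite part of the name. *)
Lemma tight_name_exists y :
  exists q, forall n, Rabs (nu_Q (q n) - y) <= / 2 ^ n / 2.
Proof.
assert (H : forall n, {c | Rabs (nu_Q c - y) <= / 2 ^ n / 2}).
{ intros n; apply constructive_indefinite_description.
  pose proof (inv_pow2_pos n).
  destruct (nu_Q_dense (y - / 2 ^ n / 2) (y + / 2 ^ n / 2)) as [c Hc]; [lra|].
  exists c; apply Rabs_le; lra. }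
exists (fun n => proj1_sig (H n)); intros n; exact (proj2_sig (H n)).
Qed.

Lemma cauchy_name_exists y : exists q, cauchy_name q y.
Proof.
destruct (tight_name_exists y) as [q Hq]; exists q; intros n.
specialize (Hq n); pose proof (inv_pow2_pos n); lra.
Qed.

(** The first [n] entries are kept: each has spent half of its tolerance, and the move costs at most
    the other half because [/ 2 ^ n <= / 2 ^ i] for [i < n]. Later entries come from any name of
    [y']. *)
Lemma tight_name_perturb q y y' n :
  (forall n, Rabs (nu_Q (q n) - y) <= / 2 ^ n / 2) ->
  Rabs (y' - y) <= / 2 ^ n / 2 ->
  exists q', agree n q q' /\ cauchy_name q' y'.
Proof.
intros Hq Hy; destruct (cauchy_name_exists y') as [q1 H1].
exists (fun i => if (i <? n)%nat then q i else q1 i); split.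
- intros i Hi; apply Nat.ltb_lt in Hi; now rewrite Hi.
- intros i; destruct (Nat.ltb_spec i n) as [L|L]; [|apply H1].
  specialize (Hq i).
  assert (/ 2 ^ n <= / 2 ^ i) by (apply inv_pow2_le; lia).
  replace (nu_Q (q i) - y') with ((nu_Q (q i) - y) - (y' - y)) by ring.
  eapply Rle_trans; [apply Rabs_triang|rewrite Rabs_Ropp; lra].
Qed.

(** * Negative information and compactness of intervals *)

Definition unlisted (k : Baire) (x : R) : Prop :=
  ~ exists i, interval_code (k i) x.

Lemma interval_code_pair a b x :
  interval_code (Cantor.to_nat (a, b)) x <-> nu_Q a < x < nu_Q b.
Proof. unfold interval_code; rewrite Cantor.cancel_of_to; tauto. Qed.

Lemma interval_code_open c x :
  interval_code c x ->
  exists d, 0 < d /\ forall y, Rabs (y - x) <= d -> interval_code c y.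
Proof.
unfold interval_code; destruct (Cantor.of_nat c) as [a b]; intros H.
exists (Rmin (x - nu_Q a) (nu_Q b - x) / 2).
pose proof (Rmin_l (x - nu_Q a) (nu_Q b - x)).
pose proof (Rmin_r (x - nu_Q a) (nu_Q b - x)).
assert (0 < Rmin (x - nu_Q a) (nu_Q b - x)) by (apply Rmin_pos; lra).
split; [lra|]; intros y Hy.
assert (Hy' := Rle_abs (y - x)); assert (Hy'' := Rle_abs (- (y - x))).
rewrite Rabs_Ropp in Hy''; lra.
Qed.

Definition open_complement (U : R -> Prop) : Prop :=
  forall x, ~ U x -> exists d, 0 < d /\ forall y, Rabs (y - x) <= d -> ~ U y.

(** Compactness as real induction: the supremum [m] of the points reachable from [s] has a reachable
    point within its own [d], and one local step from there would pass [m] unless it ends at [t]. *)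
Lemma interval_compactness (P : R -> R -> Prop) s t :
  (forall x, s <= x <= t -> exists d, 0 < d /\
     forall a b, x - d <= a -> a <= x -> x <= b -> b <= x + d -> P a b) ->
  (forall a b c, P a b -> P b c -> P a c) ->
  s <= t -> P s t.
Proof.
intros loc glue st.
set (E := fun x => s <= x <= t /\ P s x).
destruct (completeness E) as [m [ub lub]].
- exists t; intros x [H _]; lra.
- exists s; split; [lra|].
  destruct (loc s) as [d [d0 Hd]]; [lra|]; apply Hd; lra.
- assert (ms : s <= m).
  { apply ub; split; [lra|].
    destruct (loc s) as [d [d0 Hd]]; [lra|]; apply Hd; lra. }
  assert (mt : m <= t) by (apply lub; intros x [H _]; lra).
  destruct (loc m) as [d [d0 Hd]]; [lra|].
  destruct (classic (exists x, E x /\ m - d < x)) as [[x [[Hx Px] Lx]]|no].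
  + assert (xm : x <= m) by (apply ub; split; auto).
    pose proof (Rmin_l (m + d) t); pose proof (Rmin_r (m + d) t).
    assert (ym : m <= Rmin (m + d) t) by (apply Rmin_glb; lra).
    assert (Py : P s (Rmin (m + d) t)).
    { apply glue with x; auto; apply Hd; lra. }
    assert (Rmin (m + d) t <= m) by (apply ub; split; auto; lra).
    destruct (Rle_dec (m + d) t) as [L|L].
    * rewrite Rmin_left in *; lra.
    * rewrite Rmin_right in Py; auto; lra.
  + assert (m <= m - d); [|lra].
    apply lub; intros x Ex; apply Rnot_lt_le; intros L; apply no; eauto.
Qed.

(** * Finite lists of intervals and labelled covers *)

Definition len (I : R * R) : R := snd I - fst I.
Definition total (S : list (R * R)) : R :=
  fold_right (fun I acc => len I + acc) 0 S.
Definition inside (I : R * R) (x : R) : Prop := fst I <= x <= snd I.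
Definition covered (S : list (R * R)) (x : R) : Prop :=
  exists I, In I S /\ inside I x.
Definition ordered (S : list (R * R)) : Prop :=
  forall I, In I S -> fst I <= snd I.

Lemma total_app S T : total (S ++ T) = total S + total T.
Proof. induction S as [|I S IH]; simpl; [|rewrite IH]; lra. Qed.

Lemma covered_app S T x : covered (S ++ T) x <-> covered S x \/ covered T x.
Proof.
unfold covered; setoid_rewrite in_app_iff; firstorder.
Qed.

Lemma ordered_app S T : ordered S -> ordered T -> ordered (S ++ T).
Proof. intros HS HT I HI; apply in_app_iff in HI; destruct HI; auto. Qed.

Lemma total_nonneg S : ordered S -> 0 <= total S.
Proof.
induction S as [|I S IH]; simpl; intros H; [lra|].
assert (fst I <= snd I) by (apply H; left; auto).
assert (0 <= total S) by (apply IH; intros J HJ; apply H; right; auto).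
unfold len; lra.
Qed.

Section LabelledCover.
Variables (Lab : Type) (V : nat -> Lab -> R -> R -> Prop).
Hypothesis V_mono : forall n m b l r l' r',
  (n <= m)%nat -> l <= l' -> r' <= r -> V n b l r -> V m b l' r'.
Hypothesis V_local : forall x, exists d n b, 0 < d /\ V n b (x - d) (x + d).

Definition cells_ok (n : nat) (cs : list ((R * R) * Lab)) : Prop :=
  forall I b, In (I, b) cs -> V n b (fst I) (snd I).

Lemma cells_ok_app n m cs ds :
  cells_ok n cs -> cells_ok m ds -> cells_ok (Nat.max n m) (cs ++ ds).
Proof.
intros Hc Hd I b HI; apply in_app_iff in HI; destruct HI as [HI|HI].
- apply V_mono with n (fst I) (snd I); auto; try lra; lia.
- apply V_mono with m (fst I) (snd I); auto; try lra; lia.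
Qed.

(** A single stage [n] serves all cells, and the bound [v] on the total length records that cutting
    into cells costs no length. *)
Definition labelled_cover (T : R -> Prop) (v : R) : Prop :=
  exists n cs, cells_ok n cs /\ ordered (map fst cs) /\
    total (map fst cs) <= v /\ forall x, T x -> covered (map fst cs) x.

Lemma labelled_cover_union T T' v v' :
  labelled_cover T v -> labelled_cover T' v' ->
  labelled_cover (fun x => T x \/ T' x) (v + v').
Proof.
intros [n [cs [H1 [H2 [H3 H4]]]]] [m [ds [G1 [G2 [G3 G4]]]]].
exists (Nat.max n m), (cs ++ ds); rewrite map_app; repeat split.
- now apply cells_ok_app.
- now apply ordered_app.
- rewrite total_app; lra.
- intros x [Hx|Hx]; apply covered_app; auto.
Qed.

(** Local cells are glued by compactness; the lengths of adjacent intervals add up exactly. *)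
Lemma labelled_cover_interval s t :
  s <= t -> labelled_cover (fun x => s <= x <= t) (t - s).
Proof.
apply (interval_compactness
  (fun s t => labelled_cover (fun x => s <= x <= t) (t - s))).
- intros x _; destruct (V_local x) as [d [n [b [d0 Hd]]]].
  exists d; split; auto; intros u v H1 H2 H3 H4.
  exists n, [((u, v), b)]; simpl; repeat split.
  + intros I b' [E|[]]; injection E as <- <-; simpl.
    apply V_mono with n (x - d) (x + d); auto.
  + intros I [<-|[]]; simpl; lra.
  + unfold len; simpl; lra.
  + intros y Hy; exists (u, v); simpl; auto.
- intros a b c H1 H2.
  destruct (labelled_cover_union _ _ _ _ H1 H2) as [n [cs [C1 [C2 [C3 C4]]]]].
  exists n, cs; repeat split; auto; [lra|].
  intros x Hx; apply C4; lra.
Qed.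

Lemma labelled_cover_list S :
  ordered S -> labelled_cover (covered S) (total S).
Proof.
induction S as [|I S IH]; intros HS.
- exists 0%nat, []; simpl; repeat split; try easy; lra.
- destruct (labelled_cover_union (inside I) (covered S) (len I) (total S))
    as [n [cs [C1 [C2 [C3 C4]]]]].
  + apply labelled_cover_interval, HS; left; auto.
  + apply IH; intros J HJ; apply HS; right; auto.
  + exists n, cs; repeat split; auto.
    intros x [J [[<-|HJ] Hx]]; apply C4; [left|right]; auto.
    exists J; auto.
Qed.
End LabelledCover.

(** * What finitely many entries of a name decide about the query *)

Section Reduction.
Variable Name : Baire -> (R -> Prop) -> Prop.
Variables tK tH : term.
Variable U : R -> Prop.
Hypothesis U_closed : open_complement U.
Hypothesis reduces : forall p A, Name p A ->
  exists k, runs tK p k /\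
    forall q y, unlisted k y -> U y -> cauchy_name q y ->
      exists r, runs tH (bpair p q) r /\ exists z, A z /\ cauchy_name r z.

(** Quantifying over all continuations [p'] of the first [n] entries keeps the refutation valid when
    the named set is later shrunk into [side]. *)
Definition refuted (p : Baire) (side : R -> Prop) (n : nat) (l r : R) : Prop :=
  forall p' A, agree n p p' -> Name p' A -> (forall z, A z -> side z) ->
  forall k, runs tK p' k ->
  forall y, l <= y <= r -> unlisted k y -> ~ U y.

Lemma refuted_mono p side n m l r l' r' :
  (n <= m)%nat -> l <= l' -> r' <= r ->
  refuted p side n l r -> refuted p side m l' r'.
Proof.
intros nm ll rr H p' A Hp HA Hs k Hk y Hy.
apply (H p' A); auto; [apply agree_le with m; auto|lra].
Qed.

(* Around every point a finite part of [p] either excludes the point from the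
   query or fixes the [j]-th output, hence refutes every side that this output
   is far from. *)
Lemma refuted_local (Lab : Type) (side : Lab -> R -> Prop) (j : nat) p A :
  Name p A ->
  (forall c, exists b, forall z, side b z -> ~ Rabs (nu_Q c - z) <= / 2 ^ j) ->
  forall x, exists d n b, 0 < d /\ refuted p (side b) n (x - d) (x + d).
Proof.
intros HA Hside x; destruct (reduces p A HA) as [k [HK HH]].
destruct (classic (U x)) as [Ux|nU].
- destruct (classic (unlisted k x)) as [Hx|Hx].
  + destruct (tight_name_exists x) as [q Hq].
    destruct (HH q x) as [r [Hr _]]; auto.
    { intros n; specialize (Hq n); pose proof (inv_pow2_pos n); lra. }
    destruct (Hside (r j)) as [b Hb].
    destruct (eval_use _ _ _ _ (Hr j)) as [n Hn].
    (* Points this close to [x] have names that agree with [q] on the [n] entries used, so they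
       produce the same [j]-th output, which is too far from [side b]. *)
    exists (/ 2 ^ n / 2), n, b; split.
    { pose proof (inv_pow2_pos n); lra. }
    intros p' A' Hp HA' Hs k' Hk' y Hy Hyk Uy.
    destruct (tight_name_perturb q x y n Hq) as [q' [Hq' Hc]].
    { apply Rabs_le; lra. }
    destruct (reduces p' A' HA') as [k1 [HK1 HH1]].
    rewrite (runs_det _ _ _ _ HK1 Hk') in HH1.
    destruct (HH1 q' y Hyk Uy Hc) as [r' [Hr' [z [Az Hz]]]].
    apply (Hb z (Hs z Az)).
    rewrite (eval_det _ _ _ _ _ (Hn _ (agree_bpair _ _ _ _ _ Hp Hq')) (Hr' j)).
    apply Hz.
  + apply NNPP in Hx; destruct Hx as [i Hi].
    (* Any label serves here: the query entry that lists [x] is fixed by finitely many entries of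
       [p] and excludes a whole neighbourhood. *)
    destruct (Hside 0%nat) as [b _].
    destruct (interval_code_open _ _ Hi) as [d [d0 Hd]].
    destruct (eval_use _ _ _ _ (HK i)) as [n Hn].
    exists d, n, b; split; auto.
    intros p' A' Hp _ _ k' Hk' y Hy Hyk _; apply Hyk; exists i.
    rewrite <- (eval_det _ _ _ _ _ (Hn _ Hp) (Hk' i)).
    apply Hd, Rabs_le; lra.
- destruct (Hside 0%nat) as [b _].
  destruct (U_closed x nU) as [d [d0 Hd]].
  exists d, 0%nat, b; split; auto.
  intros p' A' _ _ _ k' _ y Hy _; apply Hd, Rabs_le; lra.
Qed.
End Reduction.

(** * Reductions to closed choice *)

(** A name [k] determines its set as the unlisted part of [U]. Hence a Cauchy name of any point
    there is a good answer for every set that [k] names. *)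
Lemma closed_choice_elim (X Y : rep_space)
    (f : mvmap (carrier X) (carrier Y))
    (dZ : Baire -> (R -> Prop) -> Prop) (dW : Baire -> R -> Prop)
    (dom : (R -> Prop) -> Prop) (U : R -> Prop) :
  (forall k A, dZ k A -> forall x, A x <-> unlisted k x /\ U x) ->
  (forall q y, U y -> cauchy_name q y -> dW q y) ->
  (forall A, dom A -> nonempty A) ->
  W_le X Y {| carrier := R -> Prop; delta := dZ |}
    {| carrier := R; delta := dW |} f
    {| mdom := dom; mval := fun A x => A x |} ->
  exists tK tH, forall p x, delta X p x -> mdom f x ->
    exists k, runs tK p k /\ (exists A, dZ k A /\ dom A) /\
      forall q y, unlisted k y -> U y -> cauchy_name q y ->
        exists r, runs tH (bpair p q) r /\
          exists z, delta Y r z /\ mval f x z.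
Proof.
intros HZ HW Hne Hle; apply W_le_elim in Hle.
- destruct Hle as [tK [tH H]]; exists tK, tH; intros p x Hp Hx.
  destruct (H p x Hp Hx) as [k [HK [HA Hq]]].
  exists k; repeat split; auto.
  intros q y Hy Uy Hqy; apply Hq.
  intros A dA _; exists y; split; [now apply HW|].
  apply (HZ k A dA); auto.
- intros k; destruct (classic (exists A, dZ k A /\ dom A)) as [[A [dA HA]]|no].
  + destruct (Hne A HA) as [y Hy].
    destruct (cauchy_name_exists y) as [q Hq]; exists q.
    apply (HZ k A dA) in Hy.
    intros A' dA' _; exists y; split; [apply HW; tauto|].
    now apply (HZ k A' dA').
  (* Here [k] names no admissible set, so every sequence is vacuously good; [k] itself is at
     hand. *)
  + exists k; intros A dA HA; destruct no; exists A; split; assumption.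
Qed.

(** The conjunct [True] fits the form of [closed_choice_elim] with the whole line as [U]. *)
Lemma AminusR_unlisted k A :
  delta AminusR k A -> forall x, A x <-> unlisted k x /\ True.
Proof.
intros H x; specialize (H x); unfold unlisted.
destruct (classic (A x)); tauto.
Qed.

Lemma AminusI_unlisted k A :
  delta AminusI k A -> forall x, A x <-> unlisted k x /\ unit_I x.
Proof.
intros [sub H] x; specialize (H x); specialize (sub x); unfold unlisted.
destruct (classic (A x)); tauto.
Qed.

Lemma unit_I_open_complement : open_complement unit_I.
Proof.
intros x nx; unfold unit_I in *.
destruct (Rlt_dec x 0) as [L|L].
- exists (- x / 2); split; [lra|]; intros y Hy.
  assert (H := Rle_abs (y - x)); lra.
- exists ((x - 1) / 2); split; [lra|]; intros y Hy.
  assert (H := Rle_abs (- (y - x))); rewrite Rabs_Ropp in H; lra.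
Qed.

(** * Null sets and the positive measure of intervals *)

Lemma lebesgue_null_sub (A B : R -> Prop) :
  (forall x, A x -> B x) -> lebesgue_null B -> lebesgue_null A.
Proof.
intros AB HB eps He; destruct (HB eps He) as [a [b [H1 [H2 H3]]]].
exists a, b; repeat split; auto.
Qed.

(** Remove the interval that contains [t]: being open, it misses everything up to its left end, so
    the others cover that part and induction applies. *)
Lemma total_open_cover n : forall S s t, length S = n -> ordered S -> s <= t ->
  (forall x, s <= x <= t -> exists I, In I S /\ fst I < x < snd I) ->
  t - s <= total S.
Proof.
induction n as [|n IH]; intros S s t HL HS st Hc.
- destruct S; [|discriminate].
  destruct (Hc s) as [I [[] _]]; lra.
- destruct (Hc t) as [I [HI It]]; [lra|].
  destruct (in_split I S HI) as [S1 [S2 ->]].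
  assert (HS' : ordered (S1 ++ S2)).
  { intros J HJ; apply HS; apply in_app_iff in HJ; apply in_app_iff.
    simpl; tauto. }
  rewrite total_app; simpl; unfold len at 1.
  assert (E := total_app S1 S2).
  destruct (Rlt_dec (fst I) s) as [L|L].
  + pose proof (total_nonneg _ HS'); lra.
  + assert (fst I - s <= total (S1 ++ S2)); [|lra].
    apply IH; auto; try lra.
    * rewrite length_app in *; simpl in HL; lia.
    * intros x Hx; destruct (Hc x) as [J [HJ Jx]]; [lra|].
      exists J; split; auto; apply in_app_iff in HJ; apply in_app_iff.
      destruct HJ as [HJ|[<-|HJ]]; auto; lra.
Qed.

Lemma total_initial (a b : nat -> R) n :
  total (map (fun i => (a i, b i)) (seq 0 (S n))) =
  sum_f_R0 (fun i => b i - a i) n.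
Proof.
induction n as [|n IH]; [simpl; unfold len; simpl; lra|].
rewrite seq_S, map_app, total_app, IH; simpl; unfold len; simpl; lra.
Qed.

(** Compactness extracts a finite subcover, whose total length is at least [t - s], from a countable
    cover of total at most half of that. *)
Lemma interval_positive_measure (A : R -> Prop) s t :
  s < t -> (forall x, s <= x <= t -> A x) -> positive_measure A.
Proof.
intros st HA Hnull.
destruct (Hnull ((t - s) / 2)) as [a [b [ab [cov sum]]]]; [lra|].
assert (fin : exists n, forall x, s <= x <= t ->
          exists i, (i <= n)%nat /\ a i < x < b i).
{ apply (interval_compactness (fun u v => exists n, forall x, u <= x <= v ->
    exists i, (i <= n)%nat /\ a i < x < b i)); [| |lra].
  - intros x Hx; destruct (cov x (HA x Hx)) as [i Hi].
    pose proof (Rmin_l (x - a i) (b i - x)).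
    pose proof (Rmin_r (x - a i) (b i - x)).
    assert (0 < Rmin (x - a i) (b i - x)) by (apply Rmin_pos; lra).
    exists (Rmin (x - a i) (b i - x) / 2); split; [lra|].
    intros u v L1 L2 L3 L4; exists i; intros y Hy.
    exists i; split; [lia|lra].
  - intros u v w [n Hn] [m Hm]; exists (Nat.max n m); intros x Hx.
    destruct (Rle_dec x v).
    + destruct (Hn x) as [i [Hi Hi']]; [lra|].
      exists i; split; [lia|auto].
    + destruct (Hm x) as [i [Hi Hi']]; [lra|].
      exists i; split; [lia|auto]. }
destruct fin as [n Hn]; specialize (sum n).
rewrite <- total_initial in sum.
assert (t - s <= total (map (fun i => (a i, b i)) (seq 0 (S n)))); [|lra].
apply total_open_cover with (1 := eq_refl); [|lra|].
- intros I HI; apply in_map_iff in HI; destruct HI as [i [<- _]]; apply ab.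
- intros x Hx; destruct (Hn x Hx) as [i [Hi Hi']].
  exists (a i, b i); split; [|exact Hi'].
  apply in_map_iff; exists i; split; auto; apply in_seq; lia.
Qed.

(** * Positive choice on the line does not reduce to interval choice *)

Definition empty_code : nat := Cantor.to_nat (0%nat, 0%nat).

Lemma empty_code_spec x : ~ interval_code empty_code x.
Proof. unfold empty_code; rewrite interval_code_pair; lra. Qed.

(** The first [n] entries exclude nothing, so the name starts like that of the whole line.
    Afterwards even and odd offsets run through all rationals and exhaust the left and the right
    ray. *)
Definition delayed_interval_name (n al be : nat) : Baire := fun i =>
  if (i <? n)%nat then empty_code
  else if Nat.even (i - n) then Cantor.to_nat (Nat.div2 (i - n), al)
  else Cantor.to_nat (be, Nat.div2 (i - n)).

Lemma delayed_interval_name_spec n al be :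
  delta AminusR (delayed_interval_name n al be)
    (fun x => nu_Q al <= x <= nu_Q be).
Proof.
intros x; unfold delayed_interval_name; split.
- intros Hx; destruct (Rlt_dec x (nu_Q al)) as [L|L].
  + destruct (nu_Q_dense (x - 1) x) as [a Ha]; [lra|].
    exists (n + 2 * a)%nat.
    replace (n + 2 * a <? n)%nat with false
      by (symmetry; apply Nat.ltb_ge; lia).
    replace (n + 2 * a - n)%nat with (2 * a)%nat by lia.
    rewrite Nat.even_mul, Nat.div2_double; simpl orb; cbv iota.
    rewrite interval_code_pair; lra.
  + assert (nu_Q be < x) by (apply Rnot_le_lt; intro; apply Hx; lra).
    destruct (nu_Q_dense x (x + 1)) as [b Hb]; [lra|].
    exists (n + S (2 * b))%nat.
    replace (n + S (2 * b) <? n)%nat with false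
      by (symmetry; apply Nat.ltb_ge; lia).
    replace (n + S (2 * b) - n)%nat with (S (2 * b)) by lia.
    rewrite Nat.even_succ, Nat.odd_mul, Nat.div2_succ_double.
    simpl andb; cbv iota.
    rewrite interval_code_pair; lra.
- intros [i Hi] Hx; destruct (i <? n)%nat.
  + now apply empty_code_spec in Hi.
  + destruct (Nat.even (i - n)); rewrite interval_code_pair in Hi; lra.
Qed.

Lemma PC_R_not_le_ConC_I : ~ W_le AminusR RR AminusI II PC_R ConC_I.
Proof.
intros Hle.
apply (closed_choice_elim _ _ _ _ _ _ unit_I AminusI_unlisted) in Hle.
2: { intros q y Uy Hq; split; auto. }
2: { intros A [a [b [H1 [H2 [H3 H]]]]]; exists a; apply H; lra. }
destruct Hle as [tK [tH Hred]].
set (Name p A := delta AminusR p A /\ mdom PC_R A).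
set (p0 := (fun _ => empty_code) : Baire).
assert (N0 : Name p0 (fun _ => True)).
{ split; [|split].
  - intros x; split; [tauto|]; intros [i Hi]; now apply empty_code_spec in Hi.
  - now exists 0.
  - apply interval_positive_measure with 0 1; auto; lra. }
assert (loc := refuted_local Name tK tH unit_I unit_I_open_complement).
(* Label [M] stands for sets beyond [M]. Output entry 0 has tolerance 1, so it rules out label [M]
   once [M] exceeds its value by more than 1. *)
specialize (fun h => loc h nat (fun M z => INR M < z) 0%nat p0 _ N0).
destruct (labelled_cover_interval nat
  (fun n M l r => refuted Name tK unit_I p0 (fun z => INR M < z) n l r))
  with (s := 0) (t := 1) as [n [cs [ok [_ [_ cov]]]]].
- intros n m M l r l' r'; apply refuted_mono.
- apply loc.
  + intros p A [HA HA']; destruct (Hred p A HA HA') as [k [HK [_ H]]].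
    exists k; split; auto; intros q y H1 H2 H3.
    destruct (H q y H1 H2 H3) as [r [Hr [z [Hz Az]]]].
    exists r; split; auto; exists z; split; auto.
  + intros c; destruct (INR_unbounded (nu_Q c + 1)) as [M HM].
    exists M; intros z Hz H; simpl in H.
    assert (H' := Rle_abs (- (nu_Q c - z))); rewrite Rabs_Ropp in H'; lra.
- lra.
(* An interval beyond the largest label refutes all cells at once, hence all of [unit_I], although
   the query must contain its left end [a]. *)
- set (M := list_max (map snd cs)).
  destruct (nu_Q_dense (INR M) (INR M + 1)) as [al Hal]; [lra|].
  destruct (nu_Q_dense (INR M + 1) (INR M + 2)) as [be Hbe]; [lra|].
  set (p1 := delayed_interval_name n al be).
  set (A1 := fun x => nu_Q al <= x <= nu_Q be).
  assert (N1 : Name p1 A1).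
  { split; [apply delayed_interval_name_spec|split].
    - exists (nu_Q al); unfold A1; lra.
    - apply interval_positive_measure with (nu_Q al) (nu_Q be); auto; lra. }
  destruct (Hred p1 A1 (proj1 N1) (proj2 N1))
    as [k [HK [[A [dA [a [b [H1 [H2 [H3 HA]]]]]]] _]]].
  assert (Aa : A a) by (apply HA; lra).
  apply (AminusI_unlisted k A dA) in Aa; destruct Aa as [ak Ua].
  destruct (cov a Ua) as [I [HI Ia]].
  apply in_map_iff in HI; destruct HI as [[I' M'] [E HI]]; simpl in E; subst I'.
  refine (ok I M' HI p1 A1 _ N1 _ k HK a Ia ak Ua).
  + intros i Hi; unfold p1, delayed_interval_name.
    apply Nat.ltb_lt in Hi; now rewrite Hi.
  + intros z [Hz _].
    assert (HM : (M' <= M)%nat).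
    { unfold M; assert (F := proj1 (list_max_le (map snd cs) _) (le_n _)).
      rewrite Forall_forall in F; apply F, in_map_iff.
      exists (I, M'); auto. }
    apply le_INR in HM; lra.
Qed.

(** * Limits of growing lists, and null sets from finite covers *)

Definition extends (p : Baire) (w : list nat) : Prop :=
  forall i, (i < length w)%nat -> p i = nth i w empty_code.

(** Proper growth gives list [S i] an entry [i], which no later list changes. This serves both for
    names built in stages and for countable covers. *)
Lemma growing_lists_limit (T : Type) (d : T) (L : nat -> list T) :
  (forall n, exists u, L (S n) = L n ++ u /\ u <> []) ->
  exists f : nat -> T, forall n,
    (n <= length (L n))%nat /\
    forall i, (i < length (L n))%nat -> f i = nth i (L n) d.
Proof.
intros grow.
assert (size : forall n, (n <= length (L n))%nat).
{ induction n as [|n IH]; [lia|].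
  destruct (grow n) as [[|x u] [-> ne]]; [easy|].
  rewrite length_app; simpl; lia. }
assert (stable : forall n m i, (n <= m)%nat -> (i < length (L n))%nat ->
          nth i (L m) d = nth i (L n) d /\ (i < length (L m))%nat).
{ intros n m i nm Hi; induction nm as [|m nm [IH IHl]]; auto.
  destruct (grow m) as [u [-> _]].
  rewrite app_nth1, length_app by auto; split; [auto|lia]. }
exists (fun i => nth i (L (S i)) d); intros n; split; auto.
intros i Hi; destruct (Nat.le_ge_cases n (S i)) as [h|h].
- apply stable; auto.
- symmetry; apply stable; auto.
Qed.

Definition widen (eta : R) (I : R * R) : R * R := (fst I - eta, snd I + eta).

Lemma total_widen eta S :
  total (map (widen eta) S) = total S + 2 * eta * INR (length S).
Proof.
induction S as [|I S IH]; [simpl; lra|].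
simpl map; simpl total; rewrite IH; simpl length; rewrite S_INR.
unfold len; simpl; lra.
Qed.

Lemma open_cover_of_list S v :
  ordered S -> total S < v ->
  exists T, T <> [] /\ ordered T /\ total T <= v /\
    forall x, covered S x -> exists I, In I T /\ fst I < x < snd I.
Proof.
intros HS Hv.
(* The degenerate interval makes the count [c] positive and the result nonempty. Widening all [c]
   intervals by [eta] on both sides uses up exactly the slack [v - total S]. *)
set (S' := (0, 0) :: S); set (c := INR (length S')).
assert (c0 : 0 < c) by (apply lt_0_INR; simpl; lia).
set (eta := (v - total S) / (2 * c)).
assert (e0 : 0 < eta) by (apply Rdiv_lt_0_compat; lra).
exists (map (widen eta) S'); repeat split.
- discriminate.
- intros I HI; apply in_map_iff in HI; destruct HI as [J [<- HJ]].
  assert (fst J <= snd J) by (destruct HJ as [<-|HJ]; [simpl; lra|auto]).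
  simpl; lra.
- rewrite total_widen; fold c; unfold S', eta; simpl total; unfold len; simpl.
  apply Req_le; field; lra.
- intros x [I [HI Hx]]; exists (widen eta I); split.
  + apply in_map; right; auto.
  + unfold inside in Hx; simpl; lra.
Qed.

Lemma total_nth (f : nat -> R * R) L : ordered L -> forall n,
  (n < length L)%nat -> (forall i, (i <= n)%nat -> f i = nth i L (0, 0)) ->
  sum_f_R0 (fun i => snd (f i) - fst (f i)) n <= total L.
Proof.
intros HL n Hn Hf.
rewrite <- (firstn_skipn (S n) L), total_app.
assert (0 <= total (skipn (S n) L)).
{ apply total_nonneg; intros I HI; apply HL.
  rewrite <- (firstn_skipn (S n) L); apply in_app_iff; auto. }
assert (E : firstn (S n) L = map (fun i => (fst (f i), snd (f i))) (seq 0 (S n))).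
{ apply nth_ext with (d := (0, 0)) (d' := (0, 0)).
  - rewrite length_map, length_seq, length_firstn; lia.
  - intros i Hi; rewrite length_firstn in Hi.
    rewrite nth_firstn.
    replace (i <? S n)%nat with true by (symmetry; apply Nat.ltb_lt; lia).
    rewrite (nth_indep (map _ _)) with (d' := (fst (f 0%nat), snd (f 0%nat)))
      by (rewrite length_map, length_seq; lia).
    rewrite (map_nth (fun i => (fst (f i), snd (f i)))), seq_nth by lia.
    simpl; rewrite Hf by lia; apply surjective_pairing. }
rewrite E, total_initial; lra.
Qed.

(** Every point lies within [[-N, N]] for all large [N], so the lists from any index [M] on still
    cover [D], and their totals form a small geometric tail. *)
Lemma lebesgue_null_of_covers (D : R -> Prop) (C : nat -> list (R * R)) :
  (forall N, ordered (C N)) -> (forall N, total (C N) <= / 2 ^ N) ->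
  (forall N y, - INR N <= y <= INR N -> D y -> covered (C N) y) ->
  lebesgue_null D.
Proof.
intros HO HT HC eps He.
(* The tail from [M] sums to at most [2 * / 2 ^ M], and opening the intervals doubles this. *)
destruct (inv_pow2_small (eps / 4)) as [M HM]; [lra|].
assert (HW : forall j, {T | T <> [] /\ ordered T /\
    total T <= 2 * / 2 ^ (M + j) /\
    forall x, covered (C (M + j)%nat) x ->
      exists I, In I T /\ fst I < x < snd I}).
{ intros j; apply constructive_indefinite_description, open_cover_of_list; auto.
  specialize (HT (M + j)%nat); pose proof (inv_pow2_pos (M + j)); lra. }
set (T j := proj1_sig (HW j)).
assert (HTj := fun j => proj2_sig (HW j) : _ (T j)); cbv beta in HTj.
set (L := fix L n := match n with 0%nat => [] | S n => L n ++ T n end).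
assert (LO : forall n, ordered (L n)).
{ induction n as [|n IH]; [intros I []|].
  apply ordered_app; auto; apply HTj. }
assert (LT : forall n, total (L n) <= 4 * / 2 ^ M - 4 * / 2 ^ (M + n)).
{ induction n as [|n IH].
  - rewrite Nat.add_0_r; simpl; lra.
  - simpl L; rewrite total_app.
    destruct (HTj n) as [_ [_ [H _]]].
    replace (/ 2 ^ (M + S n)) with (/ 2 ^ (M + n) / 2); [lra|].
    rewrite Nat.add_succ_r; simpl; field; apply pow_nonzero; lra. }
destruct (growing_lists_limit _ (0, 0) L) as [f Hf].
{ intros n; exists (T n); split; auto; apply HTj. }
exists (fun i => fst (f i)), (fun i => snd (f i)); repeat split.
- intros i; destruct (Hf (S i)) as [H1 H2]; rewrite H2 by lia.
  apply (LO (S i)), nth_In; lia.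
- intros x Dx.
  destruct (INR_unbounded (Rabs x)) as [j Hj].
  destruct (HTj j) as [_ [_ [_ H]]]; destruct (H x) as [I [HI Hx]].
  { apply HC; auto; rewrite plus_INR; pose proof (pos_INR M).
    assert (H1 := Rle_abs x); assert (H2 := Rle_abs (- x)).
    rewrite Rabs_Ropp in H2; lra. }
  assert (HI' : In I (L (S j))) by (apply in_app_iff; auto).
  destruct (In_nth _ _ (0, 0) HI') as [i [Hi <-]].
  exists i; rewrite (proj2 (Hf (S j)) i Hi); auto.
- intros n; destruct (Hf (S n)) as [H1 H2].
  apply Rle_trans with (total (L (S n))).
  + apply total_nth; auto; intros i Hi; apply H2; lia.
  + specialize (LT (S n)); pose proof (inv_pow2_pos (M + S n)); lra.
Qed.

(** * Finite stages of names of intervals *)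

Definition interval_name (p : Baire) (A : R -> Prop) : Prop :=
  delta AminusI p A /\ mdom ConC_I A.

Record stage := { word : list nat; lo : R; hi : R }.

(** The word excludes exactly the outside of the interval, so padding it yields a name, while any
    name extending it stays inside. The strict inequality leaves room to shrink. *)
Definition stage_ok (s : stage) : Prop :=
  0 <= lo s /\ lo s < hi s /\ hi s <= 1 /\
  forall x, unit_I x ->
    ((exists c, In c (word s) /\ interval_code c x) <-> ~ lo s <= x <= hi s).

Definition refines (s s' : stage) : Prop :=
  (exists u, word s' = word s ++ u /\ u <> []) /\ lo s <= lo s' /\ hi s' <= hi s.

Lemma refines_trans s1 s2 s3 : refines s1 s2 -> refines s2 s3 -> refines s1 s3.
Proof.
intros [[u [Eu nu]] [L1 H1]] [[v [Ev nv]] [L2 H2]]; repeat split; try lra.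
exists (u ++ v); rewrite Ev, Eu, app_assoc; split; auto.
intros E; apply app_eq_nil in E; tauto.
Qed.

Definition padded (w : list nat) : Baire := fun i => nth i w empty_code.

Lemma padded_spec w x :
  (exists i, interval_code (padded w i) x) <->
  exists c, In c w /\ interval_code c x.
Proof.
split.
- intros [i Hi]; unfold padded in Hi.
  destruct (Nat.lt_ge_cases i (length w)) as [L|L].
  + exists (nth i w empty_code); split; auto; now apply nth_In.
  + rewrite nth_overflow in Hi by auto; now apply empty_code_spec in Hi.
- intros [c [Hc Hx]]; destruct (In_nth _ _ empty_code Hc) as [i [_ Hi]].
  exists i; unfold padded; now rewrite Hi.
Qed.

Lemma padded_name s :
  stage_ok s -> interval_name (padded (word s)) (fun x => lo s <= x <= hi s).
Proof.
intros [H0 [H1 [H2 H]]]; split; [split|].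
- intros x Hx; unfold unit_I; lra.
- intros x Ux; rewrite padded_spec, (H x Ux); tauto.
- exists (lo s), (hi s); repeat split; try tauto; lra.
Qed.

Lemma name_within s p A z :
  stage_ok s -> interval_name p A -> extends p (word s) -> A z ->
  lo s <= z <= hi s.
Proof.
intros [_ [_ [_ H]]] [[sub HA] _] Hp Az; apply NNPP; intros nz.
apply (H z (sub z Az)) in nz; destruct nz as [c [Hc Hz]].
destruct (In_nth _ _ empty_code Hc) as [i [Hi E]].
apply (HA z (sub z Az)); auto; exists i; now rewrite (Hp i Hi), E.
Qed.

(** New information is placed behind [n] copies of [empty_code], so everything decided by the first
    [n] entries of the padded name remains decided. *)
Lemma stage_shrink s a b n :
  stage_ok s -> lo s <= a -> a < b -> b <= hi s ->
  exists s', stage_ok s' /\ refines s s' /\ a <= lo s' /\ hi s' <= b /\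
    forall p, extends p (word s') ->
      extends p (word s) /\ agree n (padded (word s)) p.
Proof.
intros [H0 [H1 [H2 H]]] la ab bh.
destruct (nu_Q_dense a b) as [al Hal]; auto.
destruct (nu_Q_dense (nu_Q al) b) as [be Hbe]; [lra|].
(* With [ga] and [de] outside [unit_I], two open intervals exclude precisely the rest of
   [unit_I]. *)
destruct (nu_Q_dense (-1) 0) as [ga Hga]; [lra|].
destruct (nu_Q_dense 1 2) as [de Hde]; [lra|].
set (u := repeat empty_code n ++
            [Cantor.to_nat (ga, al); Cantor.to_nat (be, de)]).
exists {| word := word s ++ u; lo := nu_Q al; hi := nu_Q be |}.
split; [|split; [|split; [|split]]]; simpl; try lra.
- split; [|split; [|split]]; simpl; try lra.
  intros x Ux; unfold unit_I in Ux; unfold u; split.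
  + intros [c [Hc Hx]].
    apply in_app_iff in Hc; destruct Hc as [Hc|Hc].
    * assert (~ lo s <= x <= hi s) by (apply H; eauto); lra.
    * apply in_app_iff in Hc; destruct Hc as [Hc|[<-|[<-|[]]]].
      -- apply repeat_spec in Hc; subst c; now apply empty_code_spec in Hx.
      -- rewrite interval_code_pair in Hx; lra.
      -- rewrite interval_code_pair in Hx; lra.
  + intros nx; destruct (Rlt_dec x (nu_Q al)) as [L|L].
    * exists (Cantor.to_nat (ga, al)); rewrite interval_code_pair.
      split; [|lra]; rewrite !in_app_iff; simpl; auto.
    * exists (Cantor.to_nat (be, de)); rewrite interval_code_pair.
      split; [|lra]; rewrite !in_app_iff; simpl; auto.
- split; simpl; [|lra].
  exists u; split; auto; unfold u; intros E; apply app_eq_nil in E; easy.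
- intros p Hp; split.
  + intros i Hi; rewrite Hp by (rewrite length_app; lia).
    now rewrite app_nth1.
  + intros i Hi; unfold padded; rewrite Hp.
    * destruct (Nat.lt_ge_cases i (length (word s))) as [L|L].
      -- now rewrite app_nth1.
      -- rewrite app_nth2, (nth_overflow (word s)) by auto; unfold u.
         rewrite app_nth1 by (rewrite repeat_length; lia).
         apply nth_repeat.
    * unfold u; rewrite !length_app, repeat_length; lia.
Qed.

(** * An interval whose query is a null set *)

Section IntervalChoice.
Variables tK tH : term.
Variable U : R -> Prop.
Hypothesis U_closed : open_complement U.
Hypothesis reduces : forall p A, interval_name p A ->
  exists k, runs tK p k /\
    forall q y, unlisted k y -> U y -> cauchy_name q y ->
      exists r, runs tH (bpair p q) r /\ exists z, A z /\ cauchy_name r z.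

(** All interval names extending the word are included, so the bound on the query persists through
    later stages and in the limit. *)
Definition confined (T : R -> Prop) (s : stage) (S : list (R * R)) : Prop :=
  forall p A, interval_name p A -> extends p (word s) ->
  forall k, runs tK p k ->
  forall y, T y -> unlisted k y -> U y -> covered S y.

Definition cells_not (b : bool) (cs : list ((R * R) * bool)) : list (R * R) :=
  map fst (filter (fun c => negb (Bool.eqb (snd c) b)) cs).

Lemma total_cells_not cs :
  total (cells_not true cs) + total (cells_not false cs) = total (map fst cs).
Proof.
unfold cells_not; induction cs as [|[I []] cs IH]; simpl in *; lra.
Qed.

(* The cells that survive a restriction to the left third of the interval and
   those that survive a restriction to the right third are distinct, so one of
   the two restrictions halves the total length. *)
Lemma confined_halve T s S :
  stage_ok s -> ordered S -> confined T s S ->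
  exists s' S', stage_ok s' /\ refines s s' /\ ordered S' /\
    total S' <= total S / 2 /\ confined T s' S'.
Proof.
intros ok HS HT.
assert (lh : lo s < hi s) by apply ok.
set (w := hi s - lo s).
set (side := fun (b : bool) z =>
  if b then z <= lo s + w / 3 else hi s - w / 3 <= z).
(* The midpoint is [w / 6] away from both outer thirds, so an output this precise rules out the
   right third if it is at most the midpoint, and the left third otherwise. *)
destruct (inv_pow2_small (w / 6)) as [j Hj]; [unfold w; lra|].
destruct (labelled_cover_list bool (fun n b l r => refuted interval_name tK U
    (padded (word s)) (side b) n l r)) with (S := S)
  as [n [cs [C1 [C2 [C3 C4]]]]]; auto.
- intros n m b l r l' r'; apply refuted_mono.
- apply refuted_local with (1 := U_closed) (2 := reduces) (j := j)
    (A := fun x => lo s <= x <= hi s).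
  + now apply padded_name.
  + intros c.
    assert (E1 := fun z => Rle_abs (nu_Q c - z)).
    assert (E2 := fun z => Rle_abs (- (nu_Q c - z))).
    setoid_rewrite Rabs_Ropp in E2.
    destruct (Rle_dec (nu_Q c) (lo s + w / 2)) as [L|L].
    * exists false; intros z Hz H; simpl in Hz; specialize (E2 z).
      unfold w in *; lra.
    * exists true; intros z Hz H; simpl in Hz; specialize (E1 z).
      unfold w in *; lra.
- assert (exists b, total (cells_not b cs) <= total S / 2) as [b Hb].
  { pose proof (total_cells_not cs).
    destruct (Rle_dec (total (cells_not true cs)) (total S / 2));
      [exists true|exists false]; lra. }
  destruct (stage_shrink s (if b then lo s else hi s - w / 3)
    (if b then lo s + w / 3 else hi s) n ok) as [s' [ok' [ref [Ha [Hb' ext]]]]];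
    try (unfold w; destruct b; lra).
  exists s', (cells_not b cs); split; [|split; [|split; [|split]]]; auto.
  + intros I HI; apply C2; unfold cells_not in HI.
    apply in_map_iff in HI; destruct HI as [c [<- Hc]].
    apply in_map; now apply filter_In in Hc.
  + intros p A HA Hp k HK y Ty yk Uy.
    destruct (ext p Hp) as [Hp1 Hp2].
    destruct (C4 y (HT p A HA Hp1 k HK y Ty yk Uy)) as [I [HI Iy]].
    apply in_map_iff in HI; destruct HI as [[I' b'] [E Hc]]; simpl in E; subst I'.
    destruct (Bool.bool_dec b' b) as [->|ne].
    (* A cell labelled [b] is refuted, as the new stage lies on side [b] and repeats the first [n]
       entries. *)
    * exfalso.
      refine (C1 I b Hc p A Hp2 HA _ k HK y Iy yk Uy).
      intros z Az; assert (Hz := name_within s' p A z ok' HA Hp Az).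
      unfold side; destruct b; lra.
    * exists I; split; auto; unfold cells_not; apply in_map_iff.
      exists (I, b'); split; auto; apply filter_In; split; auto.
      simpl; apply Bool.eqb_false_iff in ne; now rewrite ne.
Qed.

Lemma confined_small N s :
  stage_ok s ->
  exists s' S, stage_ok s' /\ refines s s' /\ ordered S /\
    total S <= / 2 ^ N /\ confined (fun y => - INR N <= y <= INR N) s' S.
Proof.
intros ok; assert (N0 := pos_INR N).
assert (it : forall m, exists s' S, stage_ok s' /\ refines s s' /\ ordered S /\
  total S <= 2 * INR N * / 2 ^ m /\
  confined (fun y => - INR N <= y <= INR N) s' S).
{ induction m as [|m [s1 [S1 [ok1 [ref1 [ord1 [tot1 conf1]]]]]]].
  (* Since [refines] demands proper growth, one halving of [[-N, N]] is made even for [m = 0]. *)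
  - destruct (confined_halve (fun y => - INR N <= y <= INR N) s
      [(- INR N, INR N)] ok) as [s' [S' [H1 [H2 [H3 [H4 H5]]]]]].
    + intros I [<-|[]]; simpl; lra.
    + intros p A _ _ k _ y Hy _ _; exists (- INR N, INR N); simpl; auto.
    + exists s', S'; split; [|split; [|split; [|split]]]; auto.
      simpl in H4; unfold len in H4; simpl in *; lra.
  - destruct (confined_halve _ s1 S1 ok1 ord1 conf1)
      as [s' [S' [H1 [H2 [H3 [H4 H5]]]]]].
    exists s', S'; split; [|split; [|split; [|split]]]; auto.
    + apply (refines_trans _ _ _ ref1 H2).
    + replace (/ 2 ^ S m) with (/ 2 ^ m / 2); [lra|].
      simpl; field; apply pow_nonzero; lra. }
(* The added 1 keeps the divisor positive for [N = 0]. *)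
destruct (inv_pow2_small (/ 2 ^ N / (2 * INR N + 1))) as [m Hm].
{ apply Rdiv_lt_0_compat; [apply inv_pow2_pos|lra]. }
destruct (it m) as [s' [S [H1 [H2 [H3 [H4 H5]]]]]].
exists s', S; split; [|split; [|split; [|split]]]; auto.
apply Rmult_lt_compat_r with (r := 2 * INR N + 1) in Hm; [|lra].
unfold Rdiv in Hm; rewrite Rmult_assoc, Rinv_l in Hm by lra.
pose proof (inv_pow2_pos m); lra.
Qed.

(** The words of successive stages converge to a name of the intersection of the nested intervals.
    It extends every stage, so its query obeys all confinements at once. *)
Lemma null_query :
  exists p A k, interval_name p A /\ runs tK p k /\
    lebesgue_null (fun y => unlisted k y /\ U y).
Proof.
(* Bundling each stage with its proof turns dependent choice into the plain recursion [st]. *)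
assert (step : forall N (s : {s | stage_ok s}),
  {t : {s | stage_ok s} * list (R * R) |
  refines (proj1_sig s) (proj1_sig (fst t)) /\ ordered (snd t) /\
  total (snd t) <= / 2 ^ N /\
  confined (fun y => - INR N <= y <= INR N) (proj1_sig (fst t)) (snd t)}).
{ intros N [s ok]; apply constructive_indefinite_description.
  destruct (confined_small N s ok) as [s' [S [ok' H]]].
  now exists (exist _ s' ok', S). }
assert (ok0 : stage_ok {| word := []; lo := 0; hi := 1 |}).
{ repeat split; simpl; try lra.
  - intros [c [[] _]].
  - unfold unit_I in *; intros nx; lra. }
set (st := fix st N := match N with
  | 0%nat => exist _ _ ok0
  | S N => fst (proj1_sig (step N (st N)))
  end).
set (s N := proj1_sig (st N)).
set (C N := snd (proj1_sig (step N (st N)))).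
assert (ok : forall N, stage_ok (s N)) by (intros N; exact (proj2_sig (st N))).
assert (Hs : forall N, refines (s N) (s (S N)) /\ ordered (C N) /\
  total (C N) <= / 2 ^ N /\
  confined (fun y => - INR N <= y <= INR N) (s (S N)) (C N))
  by (intros N; exact (proj2_sig (step N (st N)))).
destruct (growing_lists_limit nat empty_code (fun N => word (s N))) as [p Hp].
{ intros N; apply Hs. }
assert (mono : forall N M, (N <= M)%nat ->
          lo (s N) <= lo (s M) /\ hi (s M) <= hi (s N)).
{ intros N M L; induction L as [|M L IH]; [lra|].
  destruct (Hs M) as [[_ H] _]; lra. }
assert (cross : forall N M, lo (s N) <= hi (s M)).
{ intros N M.
  destruct (mono N (Nat.max N M)) as [H1 _]; [lia|].
  destruct (mono M (Nat.max N M)) as [_ H2]; [lia|].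
  destruct (ok (Nat.max N M)) as [_ [H3 _]]; lra. }
destruct (completeness (fun x => exists N, x = lo (s N))) as [a [a1 a2]].
{ exists (hi (s 0%nat)); intros x [N ->]; auto. }
{ exists (lo (s 0%nat)); eauto. }
(* The infimum of the right ends, taken as the supremum of their lower bounds. The limit may be a
   single point, which [ConC_I] admits. *)
destruct (completeness (fun x => forall N, x <= hi (s N))) as [b [b1 b2]].
{ exists (hi (s 0%nat)); intros x Hx; auto. }
{ exists (lo (s 0%nat)); auto. }
assert (aN : forall N, lo (s N) <= a) by (intros N; apply a1; eauto).
assert (bN : forall N, b <= hi (s N)) by (intros N; apply b2; intros x Hx; auto).
assert (ab : a <= b).
{ apply b1; intros N; apply a2; intros x [M ->]; auto. }
assert (HA : forall x, a <= x <= b <-> forall N, lo (s N) <= x <= hi (s N)).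
{ intros x; split.
  - intros Hx N; specialize (aN N); specialize (bN N); lra.
  - intros Hx; split.
    + apply a2; intros y [N ->]; apply Hx.
    + apply b1; intros N; apply Hx. }
destruct (ok 0%nat) as [lo0 [_ [hi0 _]]].
assert (Hname : interval_name p (fun x => a <= x <= b)).
{ specialize (aN 0%nat); specialize (bN 0%nat).
  split; [split|].
  - intros x Hx; unfold unit_I; lra.
  - intros x Ux; rewrite HA; split.
    + intros nx; apply not_all_ex_not in nx; destruct nx as [N HN].
      destruct (ok N) as [_ [_ [_ H]]]; apply (H x Ux) in HN.
      destruct HN as [c [Hc Hx]].
      destruct (In_nth _ _ empty_code Hc) as [i [Hi E]].
      exists i; rewrite (proj2 (Hp N) i Hi), E; auto.
    + intros [i Hi] Hx.
      (* Entry [i] already belongs to the word of stage [S i], which lists only points outside its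
         interval. *)
      destruct (Hp (S i)) as [Hl Hpi]; rewrite Hpi in Hi by lia.
      destruct (ok (S i)) as [_ [_ [_ H]]]; apply (H x Ux); auto.
      eexists; split; [|exact Hi]; apply nth_In; lia.
  - exists a, b; repeat split; try tauto; lra. }
destruct (reduces p _ Hname) as [k [HK _]].
exists p, (fun x => a <= x <= b), k; repeat split; try apply Hname; auto.
apply lebesgue_null_of_covers with C; try (intros N; apply Hs).
intros N y Hy [yk Uy]; destruct (Hs N) as [_ [_ [_ conf]]].
apply (conf p _ Hname (proj2 (Hp (S N))) k HK y Hy yk Uy).
Qed.
End IntervalChoice.

(** * Interval choice does not reduce to positive choice *)

(** The query from [null_query] is null, yet it must name a set of positive measure. The parameter
    [U] treats the line and the unit interval together. *)
Lemma ConC_I_not_le_positive_choice (dZ : Baire -> (R -> Prop) -> Prop)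
    (dW : Baire -> R -> Prop) (U : R -> Prop) :
  open_complement U ->
  (forall k A, dZ k A -> forall x, A x <-> unlisted k x /\ U x) ->
  (forall q y, U y -> cauchy_name q y -> dW q y) ->
  ~ W_le AminusI II {| carrier := R -> Prop; delta := dZ |}
      {| carrier := R; delta := dW |} ConC_I
      {| mdom := fun A => nonempty A /\ positive_measure A;
         mval := fun A x => A x |}.
Proof.
intros HU HZ HW Hle.
apply closed_choice_elim with (U := U) in Hle; auto; [|intros A HA; apply HA].
destruct Hle as [tK [tH Hred]].
destruct (null_query tK tH U HU) as [p [A [k [[HA HA'] [HK Hnull]]]]].
- intros p A [HA HA']; destruct (Hred p A HA HA') as [k [HK [_ H]]].
  exists k; split; auto; intros q y H1 H2 H3.
  destruct (H q y H1 H2 H3) as [r [Hr [z [[Uz Hz] Az]]]].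
  exists r; split; auto; exists z; split; auto.
- destruct (Hred p A HA HA') as [k' [HK' [[B [dB [_ HB]]] _]]].
  rewrite <- (runs_det _ _ _ _ HK HK') in dB.
  apply HB, lebesgue_null_sub with (2 := Hnull).
  intros x Bx; now apply (HZ k B dB).
Qed.

Theorem theorem15p4 :
  ~ W_le AminusI II AminusR RR ConC_I PC_R /\
  ~ W_le AminusR RR AminusI II PC_R ConC_I /\
  ~ W_le AminusI II AminusI II ConC_I PC_I.
Proof.
split; [|split].
- apply (ConC_I_not_le_positive_choice _ _ (fun _ => True)).
  + intros x nx; now destruct nx.
  + exact AminusR_unlisted.
  + intros q y _ Hq; exact Hq.
- exact PC_R_not_le_ConC_I.
- apply (ConC_I_not_le_positive_choice _ _ unit_I).
  + exact unit_I_open_complement.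
  + exact AminusI_unlisted.
  + intros q y Uy Hq; split; auto.
Qed.
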